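(* Let $X$ be an integral domain which is uniquely divisible by $2$ and by $3$, and let $f,g\colon X\to X$ be functions satisfying $$g(x+y)-g(x)-g(y)=xf(y)+yf(x)\qquad\text{for all } x,y\in X.$$ Then the following statements are equivalent: (i) $f=0$ and $g$ is additive; (ii) the function $f$ is even and $f(1)=0$; (iii) the function $g$ is odd and $g(2)=2g(1)$.
   Context: An integral domain is a commutative unitary ring that contains no zero divisors. For a positive integer $n$, $X$ is uniquely divisible by $n$ if for every $x\in X$ there is exactly one $y\in X$ with $x=ny$. A function $h\colon X\to X$ is additive if $h(x+y)=h(x)+h(y)$ for all $x,y\in X$; it is even if $h(-x)=h(x)$ for all $x\in X$, and odd if $h(-x)=-h(x)$ for all $x\in X$. Here $1$ is the unit of $X$ and $2=1+1$. *)

(* Defs.v *)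
From HB Require Import structures.
From mathcomp Require Import all_boot all_order all_algebra.

Set Implicit Arguments.
Unset Strict Implicit.
Unset Printing Implicit Defensive.

Import GRing.Theory.
Local Open Scope ring_scope.

(* Only meaningful for positive n. *)
Definition uniquely_divisible (X : nmodType) (n : nat) : Prop :=
  forall x : X, exists! y : X, x = y *+ n.

(* The library's [additive] (= [zmod_morphism]) is instead
   h (x - y) = h x - h y. *)
Definition additive_fun (X : nmodType) (h : X -> X) : Prop :=
  forall x y : X, h (x + y) = h x + h y.

Definition even_fun (X : zmodType) (h : X -> X) : Prop :=
  forall x : X, h (- x) = h x.

Definition odd_fun (X : zmodType) (h : X -> X) : Prop :=
  forall x : X, h (- x) = - h x.

(* Main.v *)
Require Import Defs.
From HB Require Import structures.
From mathcomp Require Import all_boot all_order all_algebra.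
From mathcomp Require Import ring.

(** The left-hand side of the equation is a Cauchy difference, hence a
    2-cocycle; for the right-hand side this says z D(x,y) = x D(y,z), where D is
    the Cauchy difference of f. Putting z = 1 and y = 1 yields
    D(x,y) = x y D(1,1). If f is even, then f 0 = 0 and y = -x gives
    2 f(x) = x^2 D(1,1), so f(1) = 0 forces D(1,1) = 0 and f = 0. *)

Import GRing.Theory.
Local Open Scope ring_scope.

(** Both [x] and [0] are quotients of [0] by [n], so uniqueness identifies them. *)
Lemma uniquely_divisible_mulrn_eq0 (X : nmodType) (n : nat) (x : X) :
  uniquely_divisible X n -> x *+ n = 0 -> x = 0.
Proof.
move=> /(_ 0)[y [_ uniq_y]] xn0.
by rewrite -(uniq_y x (esym xn0)); apply: uniq_y; rewrite mul0rn.
Qed.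

Section PexiderEquation.
Variables (X : comNzRingType) (f g : X -> X).
Hypothesis hfg : forall x y, g (x + y) - g x - g y = x * f y + y * f x.

Let D x y := f (x + y) - f x - f y.

Lemma pexider_g0 : g 0 = 0.
Proof.
have := hfg 0 0; rewrite addr0 !mul0r addr0 subrr sub0r.
by move/eqP; rewrite oppr_eq0 => /eqP.
Qed.

(** The equation at [y = - x]; it ties oddness of [g] to evenness of [f]. *)
Lemma pexider_gN x : g x + g (- x) = x * (f x - f (- x)).
Proof.
apply: oppr_inj; have := hfg x (- x); rewrite subrr pexider_g0 sub0r -opprD => ->.
by ring.
Qed.

Lemma pexider_g2 : g 2 - 2 * g 1 = f 1 *+ 2.
Proof.
by have := hfg 1 1; rewrite !mul1r mulr_natl !mulr2n opprD addrA.
Qed.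

Lemma pexider_cocycle x y z : z * D x y = x * D y z.
Proof.
have gD a b : g (a + b) = g a + g b + (a * f b + b * f a).
  by rewrite -hfg; ring.
(* Both bracketings of [g (x + y + z)] are expanded; all values of [g] cancel. *)
have := congr1 g (addrA x y z); rewrite !gD => /eqP.
rewrite -subr_eq0 => /eqP e.
apply/eqP; rewrite -subr_eq0 -[X in _ == X]oppr0 -e /D; apply/eqP; ring.
Qed.

(** The factor [f 1 *+ 2] is [D 1 1], written so that [pexider_g2] turns it into [g 2 - 2 * g 1]. *)
Lemma pexider_even_f x : even_fun f -> f x *+ 2 = x ^+ 2 * (f 1 *+ 2).
Proof.
move=> f_even.
have DE a b : D a b = a * b * D 1 1.
  by have := pexider_cocycle a b 1; rewrite mul1r => ->;
     have := pexider_cocycle b 1 1; rewrite mul1r => ->; rewrite mulrA.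
have f0 : f 0 = 0.
  have := DE 0 0; rewrite /D addr0 !mul0r subrr sub0r => /eqP.
  by rewrite oppr_eq0 => /eqP.
have f2E a : f a *+ 2 = a ^+ 2 * D 1 1.
  have := DE a (- a); rewrite {1}/D subrr f0 f_even => e.
  by apply: oppr_inj; rewrite -mulNr expr2 -mulrN -e; ring.
by rewrite f2E (f2E 1) expr1n mul1r.
Qed.

End PexiderEquation.

Theorem corollary3p2 (X : idomainType)
    (div2 : uniquely_divisible X 2) (div3 : uniquely_divisible X 3)
    (f g : X -> X)
    (hfg : forall x y : X, g (x + y) - g x - g y = x * f y + y * f x) :
  [<-> f =1 (fun=> 0) /\ additive_fun g;
       even_fun f /\ f 1 = 0;
       odd_fun g /\ g 2 = 2 * g 1].
Proof.
tfae=> [[f0 _]|[f_even f1]|[g_odd g2]].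
- by split=> [x|]; rewrite !f0.
- split=> [x|]; apply/eqP.
    by rewrite -addr_eq0 addrC (pexider_gN _ _ _ hfg) f_even subrr mulr0.
  by rewrite -subr_eq0 (pexider_g2 _ _ _ hfg) f1 mul0rn.
have f_even : even_fun f.
  (* For odd [g], [pexider_gN] gives [x * (f x - f (- x)) = 0]; a nonzero [x] cancels in a
     domain. *)
  move=> x; have [->|x_neq0] := eqVneq x 0; first by rewrite oppr0.
  have /esym/eqP := pexider_gN _ _ _ hfg x.
  by rewrite g_odd subrr mulf_eq0 (negPf x_neq0) subr_eq0 => /eqP.
have f0 x : f x = 0.
  (* It suffices that [f x *+ 2 = x ^+ 2 * (g 2 - 2 * g 1)] vanishes. *)
  apply: (uniquely_divisible_mulrn_eq0 _ _ _ div2).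
  by rewrite (pexider_even_f _ _ _ hfg) // -(pexider_g2 _ _ _ hfg) g2 subrr mulr0.
split=> // x y; apply/eqP.
by rewrite -subr_eq0 opprD addrA hfg !f0 !mulr0 addr0.
Qed.
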